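(* Let $R$ be a ring. Assume that $R$ is a subring of a left Noetherian ring $S$. Then each flat left $R$-module is semi-compact.
   Context: Rings are associative with identity and modules are unitary. For a left $R$-module $M$ and a left ideal $I$ of $R$, $M[I]=\{m\in M\mid Im=0\}$. $M$ is semi-compact if every set of congruences $x\equiv x_\alpha\pmod{M[I_\alpha]}$ ($\alpha\in\Lambda$, $x_\alpha\in M$, $I_\alpha$ a left ideal of $R$), each finite subset of which has a common solution in $M$, has a simultaneous solution in $M$. *)

(* Defs.v *)
From HB Require Import structures.
From mathcomp Require Import all_boot all_algebra.
From mathcomp Require Import boolp classical_sets cardinality.
From mathcomp Require Import freeg.

Set Implicit Arguments.
Unset Strict Implicit.
Unset Printing Implicit Defensive.

Import GRing.Theory.

Local Open Scope ring_scope.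
Local Open Scope classical_set_scope.
Local Open Scope quotient_scope.

(* Submodules of the left regular module R^o, on which a *: x is a * x. *)
Definition left_ideal (R : pzRingType) (I : set R) : Prop :=
  submod_closed (mem I : {pred R^o}).

Definition left_noetherian (S : pzRingType) : Prop :=
  forall I : nat -> set S,
    (forall n, left_ideal (I n)) -> (forall n, I n `<=` I n.+1) ->
    exists n, forall m, (n <= m)%N -> I m = I n.

Definition annihilated (R : pzRingType) (M : lmodType R) (I : set R) : set M :=
  [set m | forall a, I a -> a *: m = 0].

Definition semi_compact (R : pzRingType) (M : lmodType R) : Prop :=
  forall (L : Type) (x : L -> M) (I : L -> set R),
    (forall l, left_ideal (I l)) ->
    (forall F : set L, finite_set F ->
       exists y : M, forall l, F l -> annihilated (I l) (y - x l)) ->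
    exists y : M, forall l, annihilated (I l) (y - x l).

(* pzRingType does not require 1 != 0, so the zero ring is allowed throughout.
   A right R-module is a left module over the converse ring R^c, the right
   action of a on u being (a : R^c) *: u. *)
Section Tensor.
Variables (R : pzRingType) (A : lmodType R^c) (M : lmodType R).

(* The tensor product of A and M over R is the free abelian group on A * M
   modulo the subgroup generated by the bilinearity and balancing relations. *)
Local Notation free := {freeg (A * M)}.

Definition tensor_generators : set free :=
  [set z | (exists u v m, z = << (u + v, m) >> - << (u, m) >> - << (v, m) >>)
        \/ (exists u m n, z = << (u, m + n) >> - << (u, m) >> - << (u, n) >>)
        \/ (exists u (a : R) m,
              z = << ((a : R^c) *: u, m) >> - << (u, a *: m) >>)].

Definition tensor_relations : {pred free} :=
  mem (smallest [set H : set free | zmod_closed (mem H)] tensor_generators).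

Lemma tensor_relations_zmod_closed : zmod_closed tensor_relations.
Proof.
split; first by apply/mem_set => H [/= [/set_mem]].
move=> u v /set_mem Hu /set_mem Hv; apply/mem_set => H [/= cH gH].
by apply/set_mem; apply: cH.2; apply/mem_set; [apply: Hu|apply: Hv].
Qed.

HB.instance Definition _ :=
  GRing.isZmodClosed.Build free tensor_relations tensor_relations_zmod_closed.

Definition tensor := Quotient.quot tensor_relations.

HB.instance Definition _ := ZmodQuotient.on tensor.

Definition tens (u : A) (m : M) : tensor := \pi << (u, m) >>.

Lemma pi_tensor_eq0 (z : free) :
  z \in tensor_relations -> \pi_tensor z = 0.
Proof.
move=> zI; rewrite -(raddf0 (\pi_tensor : free -> tensor)); apply/eqP.
by rewrite -Quotient.idealrBE subr0.
Qed.

Lemma tens_generators (z : free) : tensor_generators z -> \pi_tensor z = 0.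
Proof. by move=> gz; apply/pi_tensor_eq0; apply/mem_set; apply: sub_gen_smallest gz. Qed.

Lemma tensDl (u v : A) (m : M) : tens (u + v) m = tens u m + tens v m.
Proof.
apply/eqP; rewrite -subr_eq0 opprD addrA -!raddfB; apply/eqP.
by apply: tens_generators; left; exists u, v, m.
Qed.

Lemma tensDr (u : A) (m n : M) : tens u (m + n) = tens u m + tens u n.
Proof.
apply/eqP; rewrite -subr_eq0 opprD addrA -!raddfB; apply/eqP.
by apply: tens_generators; right; left; exists u, m, n.
Qed.

Lemma tensZ (u : A) (a : R) (m : M) : tens ((a : R^c) *: u) m = tens u (a *: m).
Proof.
apply/eqP; rewrite -subr_eq0 -raddfB; apply/eqP.
by apply: tens_generators; right; right; exists u, a, m.
Qed.

End Tensor.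

(* The map f ⊗ M, computed on an arbitrary representative; it is well defined by
   tensor_map_pi, and characterized by tensor_map_is_zmod_morphism and
   tensor_map_tens. *)
Section TensorMap.
Variables (R : pzRingType) (A B : lmodType R^c) (M : lmodType R).
Variable f : {linear A -> B}.

Definition lift_free : {freeg (A * M)} -> zmodule (tensor B M) :=
  fglift (fun p => tens (f p.1) p.2 : zmodule (tensor B M)).

HB.instance Definition _ := GRing.isZmodMorphism.Build
  {freeg (A * M)} (zmodule (tensor B M)) lift_free (lift_is_additive _).

Lemma lift_freeU u m : lift_free << (u, m) >> = tens (f u) m.
Proof. by rewrite /lift_free liftU scale1r. Qed.

Definition tensor_map (t : tensor A M) : tensor B M := lift_free (repr t).

Lemma lift_free_relations z : z \in @tensor_relations R A M -> lift_free z = 0.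
Proof.
move=> /set_mem; apply: (@smallest_sub _ _ _ [set z | lift_free z = 0]).
  split=> [|u v /set_mem /= Hu /set_mem /= Hv]; apply/mem_set => /=.
    by rewrite raddf0.
  by rewrite raddfB /= Hu Hv subr0.
move=> _ [[u [v [m ->]]]|[[u [m [n ->]]]|[u [a [m ->]]]]] /=;
  rewrite !raddfB /= !lift_freeU.
- by rewrite raddfD tensDl -addrA -opprD subrr.
- by rewrite tensDr -addrA -opprD subrr.
- by rewrite linearZ tensZ subrr.
Qed.

Lemma tensor_map_pi z : tensor_map (\pi z) = lift_free z.
Proof.
apply/eqP; rewrite /tensor_map -subr_eq0 -raddfB; apply/eqP.
by apply: lift_free_relations; rewrite Quotient.idealrBE reprK.
Qed.

Lemma tensor_map_tens u m : tensor_map (tens u m) = tens (f u) m.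
Proof. by rewrite tensor_map_pi lift_freeU. Qed.

Lemma tensor_map_is_zmod_morphism : zmod_morphism tensor_map.
Proof.
move=> x y; rewrite -[x]reprK -[y]reprK -raddfB !tensor_map_pi.
exact: raddfB.
Qed.

HB.instance Definition _ := GRing.isZmodMorphism.Build
  (tensor A M) (tensor B M) tensor_map tensor_map_is_zmod_morphism.

End TensorMap.

Definition flat (R : pzRingType) (M : lmodType R) : Prop :=
  forall (A B : lmodType R^c) (f : {linear A -> B}),
    injective f -> injective (@tensor_map R A B M f).

(* Main.v *)
Require Import Defs.
From HB Require Import structures.
From mathcomp Require Import all_boot all_algebra.
From mathcomp Require Import boolp classical_sets cardinality.
From mathcomp Require Import freeg.

(** For a flat module M the annihilator submodules M[I] are controlled by left
ideals of the larger ring S: if every a in I lies in the left ideal of S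
generated by J, then M[J] is contained in M[I].  Indeed, let J m = 0.  The set of
s in S with s ⊗ m = 0 in S ⊗ M is a left ideal of S containing J, so it contains
I, and 1 ⊗ a m = a ⊗ m vanishes in S ⊗ M for a in I.  Flatness makes
M = R ⊗ M -> S ⊗ M injective, so a m = 0 ([flat_annihilated]).

Given congruences modulo the M[I_l], the ascending chain condition in S yields a
finite set F of indices such that the I_l with l in F generate a left ideal of S
containing every I_l ([left_noetherian_finite_generation]).  A solution y of the
congruences indexed by F then solves all of them: for any l, compare it with a
solution z of the congruences indexed by F and l.  The difference y - z is killed
by every I_k with k in F, hence by I_l, so y, like z, is congruent to x_l. *)

Set Implicit Arguments.
Unset Strict Implicit.
Unset Printing Implicit Defensive.

Import GRing.Theory.

Local Open Scope ring_scope.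
Local Open Scope classical_set_scope.
Local Open Scope quotient_scope.

Section LeftIdeals.
Variable S : pzRingType.

Definition ideal_span (X : set S) : set S := smallest (@left_ideal S) X.

Lemma left_ideal_span (X : set S) : left_ideal (ideal_span X).
Proof.
split; first by apply/mem_set => H [/= [/set_mem]].
move=> a u v /set_mem Hu /set_mem Hv; apply/mem_set => H [/= cH gH].
by apply/set_mem; apply: cH.2; apply/mem_set; [apply: Hu|apply: Hv].
Qed.

Lemma sub_ideal_span (X : set S) : X `<=` ideal_span X.
Proof. exact: sub_gen_smallest. Qed.

Lemma ideal_span_sub (X I : set S) :
  left_ideal I -> X `<=` I -> ideal_span X `<=` I.
Proof. exact: smallest_sub. Qed.

(** Otherwise every finite set of indices can be enlarged by an index whose
member is not yet covered; iterating a choice of such indices from the empty set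
gives a chain of left ideals that never becomes stationary. *)
Lemma left_noetherian_finite_generation (L : Type) (X : L -> set S) :
  left_noetherian S ->
  exists2 F : set L, finite_set F &
    forall l, X l `<=` ideal_span (\bigcup_(k in F) X k).
Proof.
move=> noethS; apply: contrapT => noF.
have uncovered (F : set L) : finite_set F ->
    exists l, ~ (X l `<=` ideal_span (\bigcup_(k in F) X k)).
  move=> finF; apply: contrapT => noL; apply: noF.
  by exists F => // l; apply: contrapT => Xl; apply: noL; exists l.
have [l0 _] := uncovered set0 (finite_set0 _).
have /choice[next nextP] (F : set L) : exists l,
    finite_set F -> ~ (X l `<=` ideal_span (\bigcup_(k in F) X k)).
  by have [/uncovered[l]|] := pselect (finite_set F); [exists l|exists l0].
pose Fs n := iter n (fun F => F `|` [set next F]) set0.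
have finFs n : finite_set (Fs n).
  elim: n => [|n IHn]; first exact: finite_set0.
  by rewrite /Fs /= finite_setU; split; [exact: IHn|exact: finite_set1].
have [|n|n stable] := noethS (fun n => ideal_span (\bigcup_(k in Fs n) X k)).
- by move=> n; apply: left_ideal_span.
- apply: ideal_span_sub; first exact: left_ideal_span.
  move=> s [k Fk Xs]; apply: sub_ideal_span; exists k => //.
  by left.
apply: (nextP (Fs n) (finFs n)).
rewrite -(stable n.+1 (leqnSn n)) => s Xs.
by apply: sub_ideal_span; exists (next (Fs n)) => //; right.
Qed.

End LeftIdeals.

(** The alias carries iota so that the right R-action on S, which depends on
iota, can be inferred from the type. *)
Definition right_restriction (R S : pzRingType) (iota : {rmorphism R -> S})
  : Type := S.

Section RightRestriction.
Variables (R S : pzRingType) (iota : {rmorphism R -> S}).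

Local Notation SR := (right_restriction iota).

HB.instance Definition _ := GRing.Zmodule.on SR.

Definition right_scale (a : R^c) (s : SR) : SR := (s : S) * iota (a : R).

Lemma right_scaleA (a b : R^c) (s : SR) :
  right_scale a (right_scale b s) = right_scale (a * b) s.
Proof. by rewrite /right_scale -mulrA -rmorphM. Qed.

Lemma right_scale1 : left_id (1 : R^c) right_scale.
Proof. by move=> s; rewrite /right_scale rmorph1 mulr1. Qed.

Lemma right_scaleDr : right_distributive right_scale +%R.
Proof. by move=> a s t; apply: mulrDl. Qed.

Lemma right_scaleDl (s : SR) : {morph right_scale^~ s : a b / a + b}.
Proof. by move=> a b; rewrite /right_scale rmorphD; apply: mulrDr. Qed.

HB.instance Definition _ := GRing.Zmodule_isLmodule.Build R^c SR
  right_scaleA right_scale1 right_scaleDr right_scaleDl.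

Definition restriction_unit (a : (R^c)^o) : SR := iota a.

Lemma restriction_unit_is_linear : linear restriction_unit.
Proof.
move=> a u v; rewrite /restriction_unit rmorphD; congr (_ + _).
exact: (rmorphM iota (u : R) (a : R)).
Qed.

HB.instance Definition _ := GRing.isLinear.Build R^c (R^c)^o SR *:%R
  restriction_unit restriction_unit_is_linear.

Definition left_mult (t : S) (s : SR) : SR := t * (s : S).

Lemma left_mult_is_linear (t : S) : linear (left_mult t).
Proof.
by move=> a u v; rewrite /left_mult; apply: etrans (mulrDr _ _ _) _; rewrite mulrA.
Qed.

HB.instance Definition _ (t : S) := GRing.isLinear.Build R^c SR SR *:%R
  (left_mult t) (left_mult_is_linear t).

End RightRestriction.

Section TensorZero.
Variables (R : pzRingType) (A : lmodType R^c) (M : lmodType R).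

Lemma tens0l (m : M) : tens (0 : A) m = 0.
Proof. by apply: (addrI (tens (0 : A) m)); rewrite -tensDl !addr0. Qed.

Lemma tens0r (u : A) : tens u (0 : M) = 0.
Proof. by apply: (addrI (tens u (0 : M))); rewrite -tensDr !addr0. Qed.

End TensorZero.

Section TensorRegular.
Variables (R : pzRingType) (M : lmodType R).

Local Notation free := {freeg ((R^c)^o * M)}.

Definition scale_free : free -> zmodule M :=
  fglift (fun p => (p.1 : R) *: p.2 : zmodule M).

HB.instance Definition _ := GRing.isZmodMorphism.Build
  free (zmodule M) scale_free (lift_is_additive _).

Lemma scale_freeU (a : (R^c)^o) (m : M) : scale_free << (a, m) >> = (a : R) *: m.
Proof. by rewrite /scale_free liftU scale1r. Qed.

Lemma scale_free_relations z : z \in @tensor_relations R (R^c)^o M ->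
  scale_free z = 0.
Proof.
move=> /set_mem; apply: (@smallest_sub _ _ _ [set z | scale_free z = 0]).
  split=> [|u v /set_mem /= Hu /set_mem /= Hv]; apply/mem_set => /=.
    by rewrite raddf0.
  by rewrite raddfB /= Hu Hv subr0.
move=> _ [[u [v [m ->]]]|[[u [m [n ->]]]|[u [a [m ->]]]]] /=;
  rewrite !raddfB /= !scale_freeU.
- by rewrite scalerDl -addrA -opprD subrr.
- by rewrite scalerDr -addrA -opprD subrr.
- by rewrite scalerA subrr.
Qed.

(** The action a ⊗ m |-> a m is well defined on R ⊗ M and sends 1 ⊗ m to m. *)
Lemma tens1_eq0 (m : M) : tens (1 : (R^c)^o) m = 0 -> m = 0.
Proof.
move=> t0; rewrite -[m](scale1r) -[LHS]scale_freeU.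
apply: scale_free_relations.
by rewrite -[X in X \in _]subr0 Quotient.idealrBE raddf0; apply/eqP.
Qed.

End TensorRegular.

Section FlatAnnihilator.
Variables (R S : pzRingType) (iota : {rmorphism R -> S}) (M : lmodType R).

Local Notation SR := (right_restriction iota).

(** Left multiplication by t on S is right R-linear, hence acts on S ⊗ M and
carries s ⊗ m to t s ⊗ m. *)
Lemma left_ideal_tens (m : M) : left_ideal [set s : S | tens (s : SR) m = 0].
Proof.
split; first by apply/mem_set; apply: tens0l.
move=> t u v /set_mem /= u0 /set_mem /= v0; apply/mem_set => /=.
rewrite (tensDl (left_mult t (u : SR)) (v : SR)) v0 addr0.
by rewrite -(tensor_map_tens (left_mult t)) u0 raddf0.
Qed.

Lemma tens_iota (a : R) (m : M) :
  tens (iota a : SR) m = tens ((1 : S) : SR) (a *: m) :> tensor SR M.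
Proof.
rewrite -(tensZ ((1 : S) : SR) a m); congr tens.
by rewrite /GRing.scale /= /right_scale mul1r.
Qed.

(** This is where both flatness and the injectivity of iota enter: they reduce
a m = 0 to 1 ⊗ a m = 0 in S ⊗ M, where membership in a left ideal of S can be
used. *)
Lemma flat_annihilated (J : set R) (a : R) (m : M) :
  injective iota -> flat M -> annihilated J m ->
  ideal_span (iota @` J) (iota a) -> a *: m = 0.
Proof.
move=> iota_inj M_flat Jm aJ; apply: tens1_eq0.
apply: (M_flat _ _ (restriction_unit iota) iota_inj).
rewrite tensor_map_tens raddf0 /restriction_unit rmorph1 -tens_iota.
apply: (ideal_span_sub (left_ideal_tens m)) aJ => _ [b Jb <-] /=.
by rewrite tens_iota Jm // tens0r.
Qed.

End FlatAnnihilator.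

Theorem proposition2p2 (R S : pzRingType) (iota : {rmorphism R -> S})
    (iota_inj : injective iota) (S_noeth : left_noetherian S)
    (M : lmodType R) (M_flat : flat M) :
  semi_compact M.
Proof.
move=> L x I _ solvable.
have [F finF genF] :=
  left_noetherian_finite_generation (fun l => iota @` I l) S_noeth.
have [y yF] := solvable F finF; exists y => l a Ia.
have [|z zF] := solvable (F `|` [set l]).
  by rewrite finite_setU; split=> //; exact: finite_set1.
(* The term z - x l is killed by I l; the term y - z, being killed by every I k
   with k in F, is killed by I l by the choice of F. *)
have -> : y - x l = (y - z) + (z - x l) by rewrite addrA subrK.
rewrite scalerDr (zF l _ a Ia) ?addr0; last by right.
apply: (@flat_annihilated _ _ iota _ (\bigcup_(k in F) I k)) => //.
  move=> b [k Fk Ib]; have -> : y - z = (y - x k) - (z - x k).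
    by rewrite opprB addrA subrK.
  by rewrite scalerBr (yF k Fk b Ib) (zF k _ b Ib) ?subr0 //; left.
by rewrite image_bigcup; apply: (genF l); exists a.
Qed.
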